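(* Let $g\in\mathbb X(\mathbb C)$ be a formal power series with radius of convergence $r(g)\in[0,+\infty]$, and let $T_g:\mathbb X_g\to\mathbb X(\mathbb C)$, $T_g(f)=g\circ f$. Then: (a) if $r(g)=0$, then $T_g$ is continuous; (b) if $r(g)>0$, then $T_g$ is continuous at every point $f=\sum_{n=0}^\infty a_nz^n\in\mathbb X_g$ such that (1) $|a_0|<r(g)$, or (2) $r(g)<+\infty$, $|a_0|=r(g)$ and $\deg(f)>0$.
   Context: $\mathbb N_0$ is the set of nonnegative integers. $\mathbb X(\mathbb C)$ is the set of all formal power series $f=\sum_{n=0}^\infty a_nz^n$ with $a_n\in\mathbb C$, with the Cauchy product; $\deg(f)=\max\{n:a_n\ne0\}\in\mathbb N_0\cup\{+\infty\}$ (so $\deg(f)>0$ means that some coefficient $a_n$ with $n\ge1$ is nonzero). Topology: $\mathbb X(\mathbb C)$ carries the metric $d(f,g)=\sum_{n\in\mathbb N_0}\frac1{2^n}\frac{|a_n-b_n|}{|a_n-b_n|+1}$ for $f=\sum a_nz^n$, $g=\sum b_nz^n$, i.e. the topology of coefficientwise convergence. $\mathbb X_g$ (below) carries the subspace topology. General composition: for $g=\sum_{k=0}^\infty b_kz^k\in\mathbb X(\mathbb C)$ let $\mathbb X_g$ be the set of all $f=\sum a_nz^n\in\mathbb X(\mathbb C)$ such that for every $n\in\mathbb N_0$ the series of complex numbers $\sum_{k=0}^\infty b_ka_n^{(k)}$ converges in $\mathbb C$, where $a_n^{(k)}$ is the coefficient of $z^n$ in the power $f^k$ ($f^0=1$).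 For $f\in\mathbb X_g$ put $g\circ f=T_g(f)=\sum_{n=0}^\infty c_nz^n$ with $c_n=\sum_{k=0}^\infty b_ka_n^{(k)}$. $f$ is allowed to have nonzero constant term. *)

(* Defs.v *)
From Stdlib Require Import Lra Lia FunctionalExtensionality.
From Stdlib Require Export Reals.
From Coquelicot Require Export Coquelicot.

Open Scope R_scope.

(** Formal power series over [C], as coefficient sequences.  The carrier
    [nat -> C] must not be used directly as a Coquelicot [UniformSpace]: the
    canonical structure there is that of uniform convergence. *)
Definition fps : Type := nat -> C.

Definition fps_one : fps := fun n => match n with O => RtoC 1 | S _ => RtoC 0 end.

Definition fps_mul (f g : fps) : fps :=
  fun n => sum_n (fun i => Cmult (f i) (g (n - i)%nat)) n.

Fixpoint fps_pow (f : fps) (k : nat) : fps :=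
  match k with
  | O => fps_one
  | S k' => fps_mul f (fps_pow f k')
  end.

(** The supremum of [{n | a_n <> 0}], which is the maximum whenever the set is
    finite and nonempty.  The zero series gets degree [m_infty]. *)
Definition fps_deg (f : fps) : Rbar :=
  Lub_Rbar (fun x : R => exists n : nat, f n <> RtoC 0 /\ x = INR n).

(** [CV_radius] takes real coefficients; the radius of convergence only depends
    on the moduli of the coefficients. *)
Definition fps_radius (g : fps) : Rbar := CV_radius (fun n => Cmod (g n)).

Definition fps_comp_term (g f : fps) (n k : nat) : C :=
  Cmult (g k) (fps_pow f k n).

Definition fps_comp_dom (g : fps) (f : fps) : Prop :=
  forall n : nat,
    exists c : C, @is_series C_AbsRing C_NormedModule (fps_comp_term g f n) c.

(** [iota] picks the unique sum of the series when there is one; the value is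
    meaningful only for [f] in [fps_comp_dom g]. *)
Definition fps_comp (g f : fps) : fps :=
  fun n => @iota C_CompleteNormedModule
             (fun c : C => @is_series C_AbsRing C_NormedModule (fps_comp_term g f n) c).

Definition fps_dist_term (f g : fps) (n : nat) : R :=
  / 2 ^ n * (Cmod (Cminus (f n) (g n)) / (Cmod (Cminus (f n) (g n)) + 1)).

Definition fps_dist (f g : fps) : R := Series (fps_dist_term f g).

Lemma fps_comp_correct (g f : fps) (n : nat) :
  fps_comp_dom g f ->
  @is_series C_AbsRing C_NormedModule (fps_comp_term g f n) (fps_comp g f n).
Proof.
  intros Hf; destruct (Hf n) as [c Hc].
  assert (E : fps_comp g f n = c).
  { unfold fps_comp.
    apply (@iota_unique C_AbsRing C_CompleteNormedModule
             (fun x : C => @is_series C_AbsRing C_NormedModule (fps_comp_term g f n) x) c).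
    - intros y Hy. exact (filterlim_locally_unique _ _ _ Hy Hc).
    - exact Hc. }
  rewrite E; exact Hc.
Qed.

Lemma fps_deg_gt0 (f : fps) :
  Rbar_lt 0 (fps_deg f) <-> exists n : nat, (0 < n)%nat /\ f n <> RtoC 0.
Proof.
  unfold fps_deg.
  destruct (Lub_Rbar_correct (fun x : R => exists n : nat, f n <> RtoC 0 /\ x = INR n))
    as [Hub Hleast].
  split.
  - intros H.
    apply Classical_Prop.NNPP; intros Hno.
    refine (Rbar_lt_not_le _ _ H (Hleast 0 _)).
    intros x [n [Hn ->]]; destruct n as [|n]; [apply Rle_refl|].
    exfalso; apply Hno; exists (S n); split; [lia|exact Hn].
  - intros [n [Hn Hfn]].
    apply Rbar_lt_le_trans with (INR n).
    + simpl. apply lt_0_INR; exact Hn.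
    + apply Hub. exists n; split; [exact Hfn|reflexivity].
Qed.

Lemma fps_dist_term_bounds (f g : fps) (n : nat) :
  0 <= fps_dist_term f g n <= (/ 2) ^ n.
Proof.
  unfold fps_dist_term.
  set (t := Cmod (Cminus (f n) (g n))).
  assert (Ht : 0 <= t) by apply Cmod_ge_0.
  assert (Hp : 0 < / 2 ^ n) by (apply Rinv_0_lt_compat, pow_lt; lra).
  assert (H0 : 0 <= t / (t + 1)).
  { apply Rmult_le_pos; [exact Ht|]. left; apply Rinv_0_lt_compat; lra. }
  assert (H1 : t / (t + 1) <= 1).
  { apply (Rmult_le_reg_r (t + 1)); [lra|].
    replace (t / (t + 1) * (t + 1)) with t by (field; lra). lra. }
  rewrite pow_inv. split; nra.
Qed.

Lemma ex_series_fps_dist (f g : fps) : ex_series (fps_dist_term f g).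
Proof.
  apply (ex_series_le (fps_dist_term f g) (fun n => (/ 2) ^ n)).
  - intros n. change (Rabs (fps_dist_term f g n) <= (/ 2) ^ n).
    destruct (fps_dist_term_bounds f g n) as [H0 H1].
    rewrite Rabs_pos_eq; assumption.
  - apply ex_series_geom. rewrite Rabs_pos_eq; lra.
Qed.

Lemma fps_dist_term_le (f g : fps) (n : nat) : fps_dist_term f g n <= fps_dist f g.
Proof.
  destruct (ex_series_fps_dist f g) as [l Hl].
  unfold fps_dist; rewrite (is_series_unique _ _ Hl).
  apply Rle_trans with (sum_n (fps_dist_term f g) n).
  - destruct n as [|n]; [rewrite sum_O; apply Rle_refl|].
    rewrite sum_Sn.
    assert (H : 0 <= sum_n (fps_dist_term f g) n).
    { rewrite sum_n_Reals. apply cond_pos_sum.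
      intros k; apply fps_dist_term_bounds. }
    change (fps_dist_term f g (S n)
            <= sum_n (fps_dist_term f g) n + fps_dist_term f g (S n)).
    lra.
  - apply (is_lim_seq_incr_compare (sum_n (fps_dist_term f g)) l Hl).
    intros k; rewrite sum_Sn.
    change (sum_n (fps_dist_term f g) k
            <= sum_n (fps_dist_term f g) k + fps_dist_term f g (S k)).
    destruct (fps_dist_term_bounds f g (S k)); lra.
Qed.

Lemma fps_dist_pos (f g : fps) : fps_dist f g >= 0.
Proof.
  apply Rle_ge, Rle_trans with (fps_dist_term f g 0).
  - apply fps_dist_term_bounds.
  - apply fps_dist_term_le.
Qed.

Lemma fps_dist_sym (f g : fps) : fps_dist f g = fps_dist g f.
Proof.
  apply Series_ext; intros n; unfold fps_dist_term.
  replace (Cminus (f n) (g n)) with (Copp (Cminus (g n) (f n))) by ring.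
  rewrite Cmod_opp; reflexivity.
Qed.

Lemma fps_dist_refl (f g : fps) : fps_dist f g = 0 <-> f = g.
Proof.
  split.
  - intros H. apply functional_extensionality; intros n.
    pose proof (fps_dist_term_le f g n) as Hn; rewrite H in Hn.
    unfold fps_dist_term in Hn.
    assert (Hp : 0 < / 2 ^ n) by (apply Rinv_0_lt_compat, pow_lt; lra).
    destruct (Cmod_ge_0 (Cminus (f n) (g n))) as [Ht|Ht].
    + exfalso.
      set (t := Cmod (Cminus (f n) (g n))) in *.
      assert (0 < t / (t + 1)).
      { apply Rmult_lt_0_compat; [exact Ht|apply Rinv_0_lt_compat; lra]. }
      nra.
    + symmetry in Ht; apply Cmod_eq_0 in Ht.
      replace (f n) with (Cplus (Cminus (f n) (g n)) (g n)) by ring.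
      rewrite Ht; ring.
  - intros <-. unfold fps_dist.
    rewrite (Series_ext _ (fun _ => 0 * 0)).
    + rewrite Series_scal_l; ring.
    + intros n; unfold fps_dist_term.
      replace (Cminus (f n) (f n)) with (RtoC 0) by ring.
      rewrite Cmod_0; field. apply pow_nonzero; lra.
Qed.

Lemma fps_dist_tri (f g h : fps) : fps_dist f g <= fps_dist f h + fps_dist h g.
Proof.
  unfold fps_dist.
  rewrite <- Series_plus by apply ex_series_fps_dist.
  apply Series_le.
  2: exact (ex_series_plus _ _ (ex_series_fps_dist f h) (ex_series_fps_dist h g)).
  intros n; split; [apply fps_dist_term_bounds|].
  unfold fps_dist_term.
  assert (Hp : 0 < / 2 ^ n) by (apply Rinv_0_lt_compat, pow_lt; lra).
  assert (Htri : Cmod (Cminus (f n) (g n))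
                 <= Cmod (Cminus (f n) (h n)) + Cmod (Cminus (h n) (g n))).
  { replace (Cminus (f n) (g n))
      with (Cplus (Cminus (f n) (h n)) (Cminus (h n) (g n))) by ring.
    apply Cmod_triangle. }
  pose proof (Cmod_ge_0 (Cminus (f n) (g n))) as Hs.
  pose proof (Cmod_ge_0 (Cminus (f n) (h n))) as Ht.
  pose proof (Cmod_ge_0 (Cminus (h n) (g n))) as Hu.
  set (s := Cmod (Cminus (f n) (g n))) in *.
  set (t := Cmod (Cminus (f n) (h n))) in *.
  set (u := Cmod (Cminus (h n) (g n))) in *.
  rewrite <- Rmult_plus_distr_l.
  apply Rmult_le_compat_l; [lra|].
  assert (E : forall x, 0 <= x -> x / (x + 1) = 1 - / (x + 1)).
  { intros x Hx; field; lra. }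
  assert (M : s / (s + 1) <= (t + u) / (t + u + 1)).
  { rewrite !E by lra. assert (/ (t + u + 1) <= / (s + 1)) by (apply Rinv_le_contravar; lra).
    lra. }
  assert (Dt : t / (t + u + 1) <= t / (t + 1)).
  { apply Rmult_le_compat_l; [exact Ht|apply Rinv_le_contravar; lra]. }
  assert (Du : u / (t + u + 1) <= u / (u + 1)).
  { apply Rmult_le_compat_l; [exact Hu|apply Rinv_le_contravar; lra]. }
  replace ((t + u) / (t + u + 1)) with (t / (t + u + 1) + u / (t + u + 1)) in M
    by (field; lra).
  lra.
Qed.

Definition fps_metric : Metric_Space :=
  Build_Metric_Space fps fps_dist
    fps_dist_pos fps_dist_sym fps_dist_refl fps_dist_tri.

(** Continuity at [f] of the restriction to [D] of [T], for the subspace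
    topology on [D]; meant for [f] in [D]. *)
Definition fps_continuous_at_on (D : fps -> Prop) (T : fps -> fps) (f : fps) : Prop :=
  limit_in fps_metric fps_metric T D f (T f).

Definition fps_continuous_on (D : fps -> Prop) (T : fps -> fps) : Prop :=
  forall f : fps, D f -> fps_continuous_at_on D T f.

(* Main.v *)
Require Import Defs.
From Stdlib Require Import Reals Lra Lia Wf_nat Classical.
From Coquelicot Require Import Coquelicot.
From mathcomp Require ssrnat binomial.

Open Scope R_scope.

(** The [n]-th coefficient of [g o f] is the series of the [b_k [z^n] f^k].
    Each term depends polynomially on finitely many coefficients of [f], so
    continuity is a matter of dominating these series uniformly for all [h] of
    the domain near [f].

    Write [h = h_0 + (h - h_0)].  By the binomial theorem [[z^n] h^k] is a
    combination of the numbers [C(k,j) h_0^(k-j)], [j <= n], with coefficients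
    that do not depend on [k].  Hence, if [|h_0| <= rho] and the coefficients
    of [h] up to [n] are bounded by [A], then [|[z^n] h^k|] is at most
    [(1+A)^n] times the sum over [j <= n] of [C(k,j) rho^(k-j)]
    ([fps_pow_coef_bound]).  So [T_g] is continuous at [f] as soon as some
    [rho] bounds [|h_0|] for [h] in the domain near [f] and the series of the
    [|b_k| C(k,j) rho^(k-j)] converges for every [j]
    ([fps_comp_continuous_of_majorant]).  Dominated convergence also reduces
    closeness in the metric to closeness of each coefficient.

    It remains to find [rho].  The coefficient [n = 0] of [g o h] is the series
    of the [b_k h_0^k], so [|h_0| <= r(g)] on the whole domain.
    - If [r(g) = 0], then [rho = 0] works: only the term [k = j] survives.
    - If [|f_0| < r(g)], any [rho] strictly between works, since
      [C(k,j) rho^(k-j) s^j <= (rho+s)^k].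
    - If [|f_0| = r(g)] and [deg f > 0], then [rho = r(g)] works, although the
      series defining [g o f] are only assumed to converge, possibly not
      absolutely.  Let [m >= 1] be least with [f_m <> 0].  The coefficient
      [[z^(mj)] f^k] equals [f_m^j C(k,j) f_0^(k-j)] plus binomial terms of
      lower order; since the [b_k [z^(mj)] f^k] are bounded in [k], induction
      on [j] shows that the [b_k C(k,j) f_0^(k-j)] are bounded in [k] for every
      [j] ([binom_term_bounded_of_comp_dom]).  Passing from [j + 2] to [j] gains
      a factor of order [1/k^2], and boundedness becomes absolute
      summability ([ex_series_binom_of_bounded]). *)

(** * Binomial terms *)

Definition bin (k j : nat) : R := INR (binomial.binomial k j).

(** As a function of [rho], the [j]-th derivative of [rho^k] divided by [j!].
    For [k < j] the truncated exponent is harmless because [bin k j = 0]. *)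
Definition binom_term (rho : R) (j k : nat) : R := bin k j * rho ^ (k - j).

Definition Cbinom_term (a : C) (j k : nat) : C :=
  Cmult (RtoC (bin k j)) (Cpow a (k - j)).

Lemma bin_pos (k j : nat) : 0 <= bin k j.
Proof. apply pos_INR. Qed.

Lemma bin_0 (k : nat) : bin k 0 = 1.
Proof. unfold bin; rewrite binomial.bin0; reflexivity. Qed.

Lemma bin_small (k j : nat) : (k < j)%nat -> bin k j = 0.
Proof.
  intros H; unfold bin; rewrite binomial.bin_small; [reflexivity|].
  destruct (@ssrnat.leP (S k) j); [reflexivity|lia].
Qed.

Lemma bin_S (k j : nat) : bin (S k) (S j) = bin k (S j) + bin k j.
Proof.
  unfold bin; rewrite binomial.binS, <- ssrnat.plusE. apply plus_INR.
Qed.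

Lemma bin_succ_right (k j : nat) : INR (S j) * bin k (S j) = INR (k - j) * bin k j.
Proof.
  unfold bin; rewrite <- !mult_INR. f_equal.
  pose proof (binomial.mul_bin_left k j) as H.
  rewrite <- ssrnat.multE, <- ssrnat.minusE in H. exact H.
Qed.

Lemma binom_term_pos (rho : R) (j k : nat) : 0 <= rho -> 0 <= binom_term rho j k.
Proof.
  intros H; apply Rmult_le_pos; [apply bin_pos|apply pow_le; exact H].
Qed.

Lemma Cmod_Cbinom_term (a : C) (j k : nat) :
  Cmod (Cbinom_term a j k) = binom_term (Cmod a) j k.
Proof.
  unfold Cbinom_term, binom_term.
  rewrite Cmod_mult, Cmod_R, Cmod_pow, Rabs_pos_eq by apply bin_pos. reflexivity.
Qed.

Lemma binom_term_S (rho : R) (j k : nat) :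
  binom_term rho (S j) (S k) = rho * binom_term rho (S j) k + binom_term rho j k.
Proof.
  unfold binom_term; rewrite bin_S.
  destruct (Nat.le_gt_cases (S j) k) as [H|H].
  - replace (S k - S j)%nat with (S (k - S j)) by lia.
    replace (k - j)%nat with (S (k - S j)) by lia. simpl; ring.
  - rewrite (bin_small k (S j)) by lia. simpl; ring.
Qed.

Lemma binom_term_0_S (rho : R) (k : nat) :
  binom_term rho 0 (S k) = rho * binom_term rho 0 k.
Proof. unfold binom_term; rewrite !bin_0, !Nat.sub_0_r; simpl; ring. Qed.

(** Pascal's rule.  It says that, for the operator [v |-> v(k+1) - a v(k)] on
    sequences, the [j+1]-st binomial term is a primitive of the [j]-th one. *)
Lemma Cbinom_term_S (a : C) (j k : nat) :
  Cbinom_term a (S j) (S k)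
  = Cplus (Cmult a (Cbinom_term a (S j) k)) (Cbinom_term a j k).
Proof.
  unfold Cbinom_term; rewrite bin_S, RtoC_plus.
  destruct (Nat.le_gt_cases (S j) k) as [H|H].
  - replace (S k - S j)%nat with (S (k - S j)) by lia.
    replace (k - j)%nat with (S (k - S j)) by lia. simpl; ring.
  - rewrite (bin_small k (S j)) by lia. simpl; ring.
Qed.

Lemma Cbinom_term_0_S (a : C) (k : nat) :
  Cbinom_term a 0 (S k) = Cmult a (Cbinom_term a 0 k).
Proof. unfold Cbinom_term; rewrite !bin_0, !Nat.sub_0_r; simpl; ring. Qed.

Lemma Cbinom_term_S_0 (a : C) (j : nat) : Cbinom_term a (S j) 0 = RtoC 0.
Proof. unfold Cbinom_term; rewrite bin_small by lia; ring. Qed.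

Lemma Cbinom_term_0_0 (a : C) : Cbinom_term a 0 0 = RtoC 1.
Proof. unfold Cbinom_term; rewrite bin_0; simpl; ring. Qed.

(** One summand of the binomial theorem is at most the whole power. *)
Lemma binom_term_le_pow (rho s : R) (j k : nat) :
  0 <= rho -> 0 <= s -> s ^ j * binom_term rho j k <= (rho + s) ^ k.
Proof.
  intros Hr Hs; revert j; induction k as [|k IH]; intros [|j].
  - unfold binom_term; rewrite bin_0; simpl; lra.
  - unfold binom_term; rewrite bin_small by lia; simpl; lra.
  - rewrite binom_term_0_S; simpl.
    pose proof (IH 0%nat) as H; simpl in H.
    assert (0 <= (rho + s) ^ k) by (apply pow_le; lra). nra.
  - rewrite binom_term_S.
    replace (s ^ S j * (rho * binom_term rho (S j) k + binom_term rho j k))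
      with (rho * (s ^ S j * binom_term rho (S j) k) + s * (s ^ j * binom_term rho j k))
      by (simpl; ring).
    change ((rho + s) ^ S k) with ((rho + s) * (rho + s) ^ k).
    pose proof (IH (S j)); pose proof (IH j). nra.
Qed.

(** * Finite sums *)

Lemma sum_n_S_head {G : AbelianMonoid} (u : nat -> G) (n : nat) :
  sum_n u (S n) = plus (u 0%nat) (sum_n (fun i => u (S i)) n).
Proof.
  unfold sum_n. rewrite sum_Sn_m by lia. rewrite sum_n_m_S. reflexivity.
Qed.

Lemma sum_n_single (i n : nat) (c : C) :
  (i <= n)%nat -> sum_n (fun k => if (k =? i)%nat then c else RtoC 0) n = c.
Proof.
  intros H; induction n as [|n IH].
  - rewrite sum_O. replace i with 0%nat by lia. reflexivity.
  - rewrite sum_Sn. destruct (Nat.eq_dec i (S n)) as [->|Hne].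
    + rewrite Nat.eqb_refl, (sum_n_ext_loc _ (fun _ => zero)).
      * unfold sum_n. rewrite sum_n_m_const_zero. apply plus_zero_l.
      * intros k Hk. destruct (Nat.eqb_spec k (S n)); [lia|reflexivity].
    + rewrite IH by lia. destruct (Nat.eqb_spec (S n) i); [lia|]. apply Cplus_0_r.
Qed.

Lemma Cmod_sum_n_le (u : nat -> C) (v : nat -> R) (n : nat) :
  (forall i, (i <= n)%nat -> Cmod (u i) <= v i) -> Cmod (sum_n u n) <= sum_n v n.
Proof.
  intros H; induction n as [|n IH].
  - rewrite !sum_O. apply H; lia.
  - rewrite !sum_Sn. eapply Rle_trans; [apply Cmod_triangle|].
    apply Rplus_le_compat; [apply IH; intros; apply H; lia|apply H; lia].
Qed.

Lemma Csum_n_mult_l (z : C) (u : nat -> C) (n : nat) :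
  sum_n (fun i => Cmult z (u i)) n = Cmult z (sum_n u n).
Proof. exact (sum_n_mult_l (K := C_Ring) z u n). Qed.

Lemma Csum_n_plus (u v : nat -> C) (n : nat) :
  sum_n (fun i => Cplus (u i) (v i)) n = Cplus (sum_n u n) (sum_n v n).
Proof. exact (sum_n_plus u v n). Qed.

(** * Powers of a series *)

Lemma fps_pow_S_O (f : fps) (k : nat) :
  fps_pow f (S k) 0%nat = Cmult (f 0%nat) (fps_pow f k 0%nat).
Proof. simpl; unfold fps_mul; rewrite sum_O; reflexivity. Qed.

Lemma fps_pow_S_S (f : fps) (k n : nat) :
  fps_pow f (S k) (S n)
  = Cplus (Cmult (f 0%nat) (fps_pow f k (S n)))
          (sum_n (fun i => Cmult (f (S i)) (fps_pow f k (n - i)%nat)) n).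
Proof. simpl; unfold fps_mul. rewrite sum_n_S_head. reflexivity. Qed.

Lemma fps_pow_coef_0 (f : fps) (k : nat) : fps_pow f k 0%nat = Cpow (f 0%nat) k.
Proof.
  induction k as [|k IH]; [reflexivity|]. rewrite fps_pow_S_O, IH. reflexivity.
Qed.

(** For [rho >= 0], the [z^n] coefficient of [(rho + z)^k / (1 - z)]. *)
Definition binom_sum (rho : R) (n k : nat) : R := sum_n (fun j => binom_term rho j k) n.

Lemma binom_sum_pos (rho : R) (n k : nat) : 0 <= rho -> 0 <= binom_sum rho n k.
Proof.
  intros H; unfold binom_sum; rewrite sum_n_Reals; apply cond_pos_sum.
  intros; apply binom_term_pos; exact H.
Qed.

Lemma binom_sum_incr (rho : R) (n m k : nat) :
  0 <= rho -> (n <= m)%nat -> binom_sum rho n k <= binom_sum rho m k.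
Proof.
  intros H Hnm; induction Hnm as [|m Hnm IH]; [lra|].
  unfold binom_sum in *; rewrite sum_Sn.
  pose proof (binom_term_pos rho (S m) k H).
  change (plus ?x ?y) with (x + y)%R. lra.
Qed.

Lemma binom_sum_next (rho : R) (n k : nat) :
  binom_sum rho (S n) k = binom_sum rho n k + binom_term rho (S n) k.
Proof. unfold binom_sum; rewrite sum_Sn; reflexivity. Qed.

Lemma binom_sum_0 (rho : R) (k : nat) : binom_sum rho 0 k = binom_term rho 0 k.
Proof. unfold binom_sum; rewrite sum_O; reflexivity. Qed.

Lemma binom_sum_S (rho : R) (n k : nat) :
  binom_sum rho (S n) (S k) = rho * binom_sum rho (S n) k + binom_sum rho n k.
Proof.
  induction n as [|n IH].
  - rewrite !binom_sum_next, !binom_sum_0, binom_term_S, binom_term_0_S. ring.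
  - rewrite binom_sum_next, IH, (binom_sum_next rho (S n) k), (binom_sum_next rho n k),
      binom_term_S. ring.
Qed.

(** The geometric identity that makes the weights [(1 + A)^n] reproduce
    themselves in the recursion for the coefficients of a power. *)
Lemma sum_geom_weight (A : R) (n : nat) :
  A * sum_n (fun i => (1 + A) ^ (n - i)) n = (1 + A) ^ S n - 1.
Proof.
  induction n as [|n IH].
  - rewrite sum_O; simpl; ring.
  - rewrite sum_n_S_head. change plus with Rplus.
    rewrite Rmult_plus_distr_l, (sum_n_ext _ (fun i => (1 + A) ^ (n - i)) ).
    + rewrite IH. rewrite Nat.sub_0_r. simpl; ring.
    + intros i; reflexivity.
Qed.

(** Induction on the exponent along [f^(k+1) = f f^k]: the constant term
    contributes [rho] times the previous bound, the other coefficients the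
    geometric sum of the weights; Pascal's rule for [binom_sum] collects them.
    The dependence on [k] is thereby separated from that on the coefficients
    of [f]. *)
Lemma fps_pow_coef_bound (f : fps) (rho A : R) (N : nat) :
  0 <= rho -> 0 <= A -> Cmod (f 0%nat) <= rho ->
  (forall i, (i <= N)%nat -> Cmod (f i) <= A) ->
  forall k n, (n <= N)%nat ->
  Cmod (fps_pow f k n) <= (1 + A) ^ n * binom_sum rho n k.
Proof.
  intros Hrho HA H0 HN k. induction k as [|k IH]; intros [|n] Hn.
  - unfold binom_sum; rewrite sum_O. unfold binom_term; rewrite bin_0; simpl.
    rewrite Cmod_1; lra.
  - simpl fps_pow. unfold fps_one. rewrite Cmod_0.
    apply Rmult_le_pos; [apply pow_le; lra|apply binom_sum_pos; exact Hrho].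
  - rewrite fps_pow_S_O, Cmod_mult.
    specialize (IH 0%nat Hn). unfold binom_sum in *; rewrite sum_O in *.
    rewrite binom_term_0_S. simpl in *.
    pose proof (binom_term_pos rho 0 k Hrho).
    pose proof (Cmod_ge_0 (f 0%nat)). pose proof (Cmod_ge_0 (fps_pow f k 0%nat)). nra.
  - rewrite fps_pow_S_S, binom_sum_S.
    eapply Rle_trans; [apply Cmod_triangle|].
    assert (Hs : Cmod (sum_n (fun i => Cmult (f (S i)) (fps_pow f k (n - i)%nat)) n)
                 <= ((1 + A) ^ S n - 1) * binom_sum rho n k).
    { rewrite <- sum_geom_weight.
      replace (A * sum_n (fun i => (1 + A) ^ (n - i)) n * binom_sum rho n k)
        with (A * binom_sum rho n k * sum_n (fun i => (1 + A) ^ (n - i)) n) by ring.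
      rewrite <- (sum_n_mult_l (K := R_Ring)).
      apply Cmod_sum_n_le. intros i Hi. rewrite Cmod_mult.
      change mult with Rmult.
      replace (A * binom_sum rho n k * (1 + A) ^ (n - i))
        with (A * ((1 + A) ^ (n - i) * binom_sum rho n k)) by ring.
      apply Rmult_le_compat; try apply Cmod_ge_0; [apply HN; lia|].
      eapply Rle_trans; [apply IH; lia|].
      apply Rmult_le_compat_l; [apply pow_le; lra|apply binom_sum_incr; [exact Hrho|lia]]. }
    rewrite Cmod_mult. specialize (IH (S n) Hn).
    pose proof (Cmod_ge_0 (f 0%nat)). pose proof (Cmod_ge_0 (fps_pow f k (S n))).
    pose proof (binom_sum_pos rho n k Hrho).
    assert (Cmod (f 0%nat) * Cmod (fps_pow f k (S n))
            <= rho * ((1 + A) ^ S n * binom_sum rho (S n) k))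
      by (apply Rmult_le_compat; assumption).
    replace ((1 + A) ^ S n * (rho * binom_sum rho (S n) k + binom_sum rho n k))
      with (rho * ((1 + A) ^ S n * binom_sum rho (S n) k)
            + (((1 + A) ^ S n - 1) * binom_sum rho n k + binom_sum rho n k)) by ring.
    lra.
Qed.

(** * Coefficients of powers as combinations of binomial terms *)

(** [c] is tracked because it is the leading coefficient: the case [c = 0]
    expresses that [v] is a combination of terms of order below [p]. *)
Definition binom_comb (a : C) (p : nat) (c : C) (v : nat -> C) : Prop :=
  exists w : nat -> C, w p = c /\
    forall k, v k = sum_n (fun i => Cmult (w i) (Cbinom_term a i k)) p.

Lemma binom_comb_zero (a : C) (p : nat) : binom_comb a p (RtoC 0) (fun _ => RtoC 0).
Proof.
  exists (fun _ => RtoC 0); split; [reflexivity|]. intros k.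
  rewrite (sum_n_ext _ (fun _ => zero)); [|intros; apply Cmult_0_l].
  unfold sum_n; rewrite sum_n_m_const_zero; reflexivity.
Qed.

Lemma binom_comb_plus (a : C) (p : nat) (c c' : C) (v v' : nat -> C) :
  binom_comb a p c v -> binom_comb a p c' v' ->
  binom_comb a p (Cplus c c') (fun k => Cplus (v k) (v' k)).
Proof.
  intros [w [Hw Hv]] [w' [Hw' Hv']].
  exists (fun i => Cplus (w i) (w' i)); split; [congruence|].
  intros k; rewrite Hv, Hv'.
  rewrite (sum_n_ext (fun i => Cmult (Cplus (w i) (w' i)) (Cbinom_term a i k))
             (fun i => Cplus (Cmult (w i) (Cbinom_term a i k))
                             (Cmult (w' i) (Cbinom_term a i k)))).
  - rewrite Csum_n_plus. reflexivity.
  - intros i. apply Cmult_plus_distr_r.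
Qed.

Lemma binom_comb_scal (a : C) (p : nat) (c z : C) (v : nat -> C) :
  binom_comb a p c v -> binom_comb a p (Cmult z c) (fun k => Cmult z (v k)).
Proof.
  intros [w [Hw Hv]].
  exists (fun i => Cmult z (w i)); split; [congruence|].
  intros k; rewrite Hv.
  rewrite (sum_n_ext (fun i => Cmult (Cmult z (w i)) (Cbinom_term a i k))
             (fun i => Cmult z (Cmult (w i) (Cbinom_term a i k)))).
  - rewrite Csum_n_mult_l. reflexivity.
  - intros i. symmetry; apply Cmult_assoc.
Qed.

Lemma binom_comb_sum (a : C) (p n : nat) (c : nat -> C) (v : nat -> nat -> C) :
  (forall i, (i <= n)%nat -> binom_comb a p (c i) (v i)) ->
  binom_comb a p (sum_n c n) (fun k => sum_n (fun i => v i k) n).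
Proof.
  intros H; induction n as [|n IH].
  - destruct (H 0%nat (le_n _)) as [w [Hw Hv]].
    exists w; split; [rewrite sum_O; exact Hw|]. intros k; rewrite sum_O; apply Hv.
  - destruct (binom_comb_plus a p _ _ _ _ (IH (fun i Hi => H i (le_S _ _ Hi)))
                (H (S n) (le_n _))) as [w [Hw Hv]].
    exists w; split; [rewrite sum_Sn; exact Hw|].
    intros k; rewrite sum_Sn; apply Hv.
Qed.

(** A first order recursion with inhomogeneity [s] raises the order by one and
    keeps the leading coefficient: the solution is [v_0] times the term of
    order [0] plus the shifted combination, by Pascal's rule. *)
Lemma binom_comb_step (a : C) (p : nat) (c : C) (s v : nat -> C) :
  binom_comb a p c s ->
  (forall k, v (S k) = Cplus (Cmult a (v k)) (s k)) ->
  binom_comb a (S p) c v.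
Proof.
  intros [w [Hw Hs]] Hv.
  exists (fun i => match i with O => v 0%nat | S i => w i end); split; [exact Hw|].
  intros k; rewrite sum_n_S_head. induction k as [|k IH].
  - rewrite Cbinom_term_0_0, (sum_n_ext _ (fun _ => zero)).
    + unfold sum_n; rewrite sum_n_m_const_zero, plus_zero_r. symmetry; apply Cmult_1_r.
    + intros i. rewrite Cbinom_term_S_0. apply Cmult_0_r.
  - rewrite Hv, IH, Hs, Cbinom_term_0_S.
    rewrite (sum_n_ext (fun i => Cmult (w i) (Cbinom_term a (S i) (S k)))
               (fun i => Cplus (Cmult a (Cmult (w i) (Cbinom_term a (S i) k)))
                               (Cmult (w i) (Cbinom_term a i k)))).
    + rewrite Csum_n_plus, Csum_n_mult_l. change plus with Cplus. ring.
    + intros i. rewrite Cbinom_term_S. change (@eq (AbelianMonoid.sort C_AbelianMonoid)) with (@eq C). ring.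
Qed.

(** With [h = f - f_0] of order at least [m], [h^j] starts at [z^(mj)] with
    coefficient [f_m^j]; so in the binomial expansion of [f^k] the powers
    [h^i] with [i > j] do not reach [z^n] for [n <= mj], and [h^j] reaches only
    [n = mj].  The proof avoids the binomial theorem in the ring of series and
    solves the recursion [f^(k+1) = f_0 f^k + h f^k] coefficient by
    coefficient. *)
Lemma fps_pow_binom_comb (f : fps) (m : nat) :
  (0 < m)%nat -> (forall i, (0 < i < m)%nat -> f i = RtoC 0) ->
  forall j n, (n <= m * j)%nat ->
  binom_comb (f 0%nat) j (if (n =? m * j)%nat then Cpow (f m) j else RtoC 0)
    (fun k => fps_pow f k n).
Proof.
  intros Hm Hf j; induction j as [|j IH]; intros n Hn.
  - replace n with 0%nat by lia. rewrite Nat.mul_0_r.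
    exists (fun _ => RtoC 1); split; [reflexivity|]. intros k.
    rewrite sum_O, fps_pow_coef_0. unfold Cbinom_term.
    rewrite bin_0, Nat.sub_0_r. symmetry.
    rewrite Cmult_1_l. apply Cmult_1_l.
  - destruct n as [|n].
    + destruct (Nat.eqb_spec 0 (m * S j)); [lia|].
      apply (binom_comb_step _ _ _ (fun _ => RtoC 0)); [apply binom_comb_zero|].
      intros k; rewrite fps_pow_S_O; ring.
    + apply (binom_comb_step _ _ _
               (fun k => sum_n (fun i => Cmult (f (S i)) (fps_pow f k (n - i)%nat)) n));
        [|intros k; apply fps_pow_S_S].
      set (c := if (S n =? m * S j)%nat then Cpow (f m) (S j) else RtoC 0).
      (* Only [i = m - 1], that is the coefficient [f m], can contribute to
         the leading coefficient. *)
      set (d := fun i : nat => if (i =? m - 1)%nat then c else RtoC 0).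
      assert (Hc : c = sum_n d n).
      { destruct (Nat.le_gt_cases (m - 1) n) as [H|H]; [symmetry; exact (sum_n_single _ _ c H)|].
        rewrite (sum_n_ext_loc _ (fun _ => zero)).
        - unfold sum_n; rewrite sum_n_m_const_zero. unfold c.
          destruct (Nat.eqb_spec (S n) (m * S j)); [nia|reflexivity].
        - intros i Hi. unfold d. destruct (Nat.eqb_spec i (m - 1)); [lia|reflexivity]. }
      rewrite Hc. apply (binom_comb_sum _ _ _ d). intros i Hi.
      unfold d; clear d Hc.
      destruct (Nat.le_gt_cases m (S i)) as [Him|Him].
      * assert (Hni : (n - i <= m * j)%nat) by nia.
        pose proof (binom_comb_scal _ _ _ (f (S i)) _ (IH _ Hni)) as H.
        replace (if (i =? m - 1)%nat then c else RtoC 0)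
          with (Cmult (f (S i)) (if (n - i =? m * j)%nat then Cpow (f m) j else RtoC 0));
          [exact H|clear H].
        unfold c.
        destruct (Nat.eqb_spec i (m - 1)), (Nat.eqb_spec (n - i) (m * j)),
          (Nat.eqb_spec (S n) (m * S j)); try nia; try ring.
        replace (S i) with m by lia. reflexivity.
      * rewrite (Hf (S i)) by lia.
        destruct (Nat.eqb_spec i (m - 1)); [lia|].
        destruct (binom_comb_zero (f 0%nat) j) as [w [Hw Hz]].
        exists w; split; [exact Hw|]. intros k; rewrite <- Hz. ring.
Qed.

(** * Bounded sequences *)

Definition Cbounded (u : nat -> C) : Prop := exists M : R, forall k, Cmod (u k) <= M.

Lemma Cbounded_plus (u v : nat -> C) :
  Cbounded u -> Cbounded v -> Cbounded (fun k => Cplus (u k) (v k)).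
Proof.
  intros [M HM] [N HN]; exists (M + N); intros k.
  eapply Rle_trans; [apply Cmod_triangle|]. apply Rplus_le_compat; auto.
Qed.

Lemma Cbounded_scal (z : C) (u : nat -> C) :
  Cbounded u -> Cbounded (fun k => Cmult z (u k)).
Proof.
  intros [M HM]; exists (Cmod z * M); intros k. rewrite Cmod_mult.
  apply Rmult_le_compat_l; [apply Cmod_ge_0|apply HM].
Qed.

Lemma Cbounded_ext (u v : nat -> C) :
  (forall k, u k = v k) -> Cbounded u -> Cbounded v.
Proof. intros E [M HM]; exists M; intros k; rewrite <- E; apply HM. Qed.

Lemma Cbounded_sum (u : nat -> nat -> C) (n : nat) :
  (forall i, (i <= n)%nat -> Cbounded (u i)) ->
  Cbounded (fun k => sum_n (fun i => u i k) n).
Proof.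
  intros H; induction n as [|n IH].
  - apply (Cbounded_ext (u 0%nat)); [intros k; rewrite sum_O; reflexivity|apply H; lia].
  - apply (Cbounded_ext (fun k => Cplus (sum_n (fun i => u i k) n) (u (S n) k))).
    + intros k; rewrite sum_Sn; reflexivity.
    + apply Cbounded_plus; [apply IH; intros; apply H; lia|apply H; lia].
Qed.

Lemma is_series_terms_bounded (u : nat -> C) (l : C) :
  @is_series C_AbsRing C_NormedModule u l -> Cbounded u.
Proof.
  intros H.
  destruct (@filterlim_bounded C_AbsRing C_NormedModule (sum_n u) (ex_intro _ l H))
    as [M HM].
  change (forall n, Cmod (sum_n u n) <= M) in HM.
  exists (M + M); intros [|k].
  - pose proof (HM 0%nat) as H0; rewrite sum_O in H0.
    pose proof (Cmod_ge_0 (u 0%nat)); lra.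
  - pose proof (HM (S k)) as H1; rewrite sum_Sn in H1; change plus with Cplus in H1.
    replace (u (S k)) with (Cplus (Cplus (sum_n u k) (u (S k))) (Copp (sum_n u k))) by ring.
    eapply Rle_trans; [apply Cmod_triangle|]. rewrite Cmod_opp.
    apply Rplus_le_compat; [exact H1|apply HM].
Qed.

(** * Summability of the binomial majorants *)

(** The coefficient of [z^0] in [g o f] is [g] evaluated at [f_0]. *)
Lemma fps_comp_dom_radius (g f : fps) :
  fps_comp_dom g f -> Rbar_le (Finite (Cmod (f 0%nat))) (fps_radius g).
Proof.
  intros Hf; destruct (Hf 0%nat) as [c Hc].
  destruct (is_series_terms_bounded _ _ Hc) as [M HM].
  apply (CV_radius_bounded (fun n => Cmod (g n))).
  exists M; intros n. specialize (HM n). unfold fps_comp_term in HM.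
  rewrite fps_pow_coef_0, Cmod_mult, Cmod_pow in HM.
  rewrite Rabs_pos_eq; [exact HM|].
  apply Rmult_le_pos; [apply Cmod_ge_0|apply pow_le, Cmod_ge_0].
Qed.

(** The coefficient of [z^(mj)] involves the terms of order up to [j] with a
    nonzero leading coefficient.  The terms of lower order are bounded by
    induction and the whole is bounded because its series converges, so the
    leading term is bounded too. *)
Lemma binom_term_bounded_of_comp_dom (g f : fps) (m : nat) :
  fps_comp_dom g f -> (0 < m)%nat -> f m <> RtoC 0 ->
  (forall i, (0 < i < m)%nat -> f i = RtoC 0) ->
  forall j, Cbounded (fun k => Cmult (g k) (Cbinom_term (f 0%nat) j k)).
Proof.
  intros Hf Hm Hfm Hmin j. induction j as [j IH] using lt_wf_ind.
  destruct (fps_pow_binom_comb f m Hm Hmin j (m * j) (le_n _)) as [w [Hw Hv]].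
  rewrite Nat.eqb_refl in Hw.
  assert (Hwj : w j <> RtoC 0) by (rewrite Hw; apply Cpow_nz; exact Hfm).
  destruct (Hf (m * j)%nat) as [c Hc]; apply is_series_terms_bounded in Hc.
  unfold fps_comp_term in Hc.
  assert (Hlead : Cbounded (fun k => Cmult (w j) (Cmult (g k) (Cbinom_term (f 0%nat) j k)))).
  { destruct j as [|j].
    - refine (Cbounded_ext _ _ _ Hc). intros k. rewrite Hv, sum_O. ring.
    - refine (Cbounded_ext _ _ _ (Cbounded_plus _ _ Hc (Cbounded_scal (Copp (RtoC 1)) _
        (Cbounded_sum (fun i k => Cmult (w i) (Cmult (g k) (Cbinom_term (f 0%nat) i k))) j
           (fun i Hi => Cbounded_scal (w i) _ (IH i (le_n_S _ _ Hi))))))).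
      intros k. cbv beta. rewrite Hv, sum_Sn.
      rewrite (sum_n_ext (fun i => Cmult (w i) (Cmult (g k) (Cbinom_term (f 0%nat) i k)))
                 (fun i => Cmult (g k) (Cmult (w i) (Cbinom_term (f 0%nat) i k)))).
      + rewrite Csum_n_mult_l. change plus with Cplus. ring.
      + intros i. change (@eq (AbelianMonoid.sort C_AbelianMonoid)) with (@eq C). ring. }
  refine (Cbounded_ext _ _ _ (Cbounded_scal (Cinv (w j)) _ Hlead)).
  intros k. field. exact Hwj.
Qed.

(** The partial sums telescope. *)
Lemma ex_series_inv_consecutive : ex_series (fun i => / (INR (S i) * INR (S (S i)))).
Proof.
  exists 1.
  change (is_lim_seq (sum_n (fun i => / (INR (S i) * INR (S (S i))))) 1).
  apply (is_lim_seq_ext (fun n => 1 - / INR (S (S n)))).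
  - intros n; induction n as [|n IH].
    + rewrite sum_O; simpl; lra.
    + rewrite sum_Sn, <- IH. change plus with Rplus.
      rewrite (S_INR (S (S n))), (S_INR (S n)).
      pose proof (pos_INR (S n)). field; lra.
  - replace (Finite 1) with (Finite (1 - 0)) by (f_equal; ring).
    apply is_lim_seq_minus'; [apply is_lim_seq_const|].
    apply (is_lim_seq_incr_1 (fun n => / INR (S n))), (is_lim_seq_incr_1 (fun n => / INR n)).
    apply (is_lim_seq_inv _ p_infty); [apply is_lim_seq_INR|discriminate].
Qed.

(** For [k = j + 2 + i] one has
    [C(k,j) (i+1)(i+2) = (j+1)(j+2) C(k,j+2)], so the terms of order [j] are
    those of order [j+2] divided by [(i+1)(i+2)], up to a constant. *)
Lemma ex_series_binom_of_bounded (u : nat -> R) (rho M : R) (j : nat) :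
  0 <= rho -> (forall k, 0 <= u k) ->
  (forall k, u k * binom_term rho (S (S j)) k <= M) ->
  ex_series (fun k => u k * binom_term rho j k).
Proof.
  intros Hrho Hu HM.
  apply (ex_series_incr_n (V := R_NormedModule) _ (S (S j))).
  apply (ex_series_le (V := R_CompleteNormedModule) _
    (fun i => scal (rho ^ 2 * INR (S j) * INR (S (S j)) * M)
                 (/ (INR (S i) * INR (S (S i)))))).
  2: apply (ex_series_scal_l (V := R_NormedModule)), ex_series_inv_consecutive.
  intros i. set (k := (S (S j) + i)%nat).
  assert (Hp := binom_term_pos rho j k Hrho). specialize (Hu k). specialize (HM k).
  change norm with Rabs. rewrite Rabs_pos_eq by (apply Rmult_le_pos; assumption).
  change scal with Rmult.
  pose proof (bin_succ_right k (S j)) as E1. pose proof (bin_succ_right k j) as E2.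
  replace (k - S j)%nat with (S i) in E1 by lia.
  replace (k - j)%nat with (S (S i)) in E2 by lia.
  unfold binom_term in *.
  replace (k - S (S j))%nat with i in HM by lia.
  replace (k - j)%nat with (S (S i)) in * by lia.
  assert (P1 : 0 < INR (S i)) by (apply lt_0_INR; lia).
  assert (P2 : 0 < INR (S (S i))) by (apply lt_0_INR; lia).
  assert (P3 : 0 <= INR (S j) * INR (S (S j))) by (apply Rmult_le_pos; apply pos_INR).
  apply (Rmult_le_reg_r (INR (S i) * INR (S (S i)))); [nra|].
  replace (rho ^ 2 * INR (S j) * INR (S (S j)) * M * / (INR (S i) * INR (S (S i)))
           * (INR (S i) * INR (S (S i))))
    with (rho ^ 2 * (INR (S j) * INR (S (S j))) * M) by (field; lra).
  replace (u k * (bin k j * rho ^ S (S i)) * (INR (S i) * INR (S (S i))))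
    with (rho ^ 2 * (INR (S j) * INR (S (S j))) * (u k * (bin k (S (S j)) * rho ^ i))).
  - apply Rmult_le_compat_l; [|exact HM]. apply Rmult_le_pos; [apply pow_le|]; assumption.
  - transitivity (rho ^ 2 * u k * rho ^ i * INR (S j) * (INR (S (S j)) * bin k (S (S j))));
      [ring|].
    rewrite E1.
    transitivity (rho ^ 2 * u k * rho ^ i * INR (S i) * (INR (S j) * bin k (S j)));
      [ring|].
    rewrite E2. simpl pow. ring.
Qed.

(** No absolute convergence is assumed on the circle of convergence: the
    convergence of all the coefficient series of [g o f] forces it. *)
Lemma ex_series_binom_boundary (g f : fps) (j : nat) :
  fps_comp_dom g f -> Rbar_lt 0 (fps_deg f) ->
  ex_series (fun k => Cmod (g k) * binom_term (Cmod (f 0%nat)) j k).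
Proof.
  intros Hf Hdeg. apply fps_deg_gt0 in Hdeg.
  destruct (dec_inh_nat_subset_has_unique_least_element
              (fun n => (0 < n)%nat /\ f n <> RtoC 0) (fun n => classic _) Hdeg)
    as [m [[[Hm Hfm] Hleast] _]].
  assert (Hmin : forall i, (0 < i < m)%nat -> f i = RtoC 0).
  { intros i Hi. apply NNPP; intros Hfi.
    specialize (Hleast i (conj (proj1 Hi) Hfi)). lia. }
  destruct (binom_term_bounded_of_comp_dom g f m Hf Hm Hfm Hmin (S (S j))) as [M HM].
  apply ex_series_binom_of_bounded with M.
  - apply Cmod_ge_0.
  - intros; apply Cmod_ge_0.
  - intros k. rewrite <- Cmod_Cbinom_term, <- Cmod_mult. apply HM.
Qed.

Lemma ex_series_binom_inside (g : fps) (rho rho' : R) (j : nat) :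
  0 <= rho < rho' -> Rbar_lt (Finite rho') (fps_radius g) ->
  ex_series (fun k => Cmod (g k) * binom_term rho j k).
Proof.
  intros [H0 Hlt] Hr.
  assert (Hs : 0 < (rho' - rho) ^ j) by (apply pow_lt; lra).
  apply (ex_series_le (V := R_CompleteNormedModule) _
    (fun k => scal (/ (rho' - rho) ^ j) (Rabs (Cmod (g k) * rho' ^ k)))).
  - intros k. change norm with Rabs; change scal with Rmult.
    assert (H : 0 <= Cmod (g k)) by apply Cmod_ge_0.
    rewrite !Rabs_pos_eq.
    + pose proof (binom_term_le_pow rho (rho' - rho) j k H0) as Hb.
      replace (rho + (rho' - rho)) with rho' in Hb by ring.
      apply (Rmult_le_reg_l ((rho' - rho) ^ j)); [exact Hs|].
      replace ((rho' - rho) ^ j * (/ (rho' - rho) ^ j * (Cmod (g k) * rho' ^ k)))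
        with (Cmod (g k) * rho' ^ k) by (field; lra).
      rewrite <- Rmult_assoc, (Rmult_comm _ (Cmod (g k))), Rmult_assoc.
      apply Rmult_le_compat_l; [exact H|apply Hb; lra].
    + apply Rmult_le_pos; [exact H|apply pow_le; lra].
    + apply Rmult_le_pos; [exact H|apply binom_term_pos, H0].
  - apply (ex_series_scal_l (V := R_NormedModule)).
    apply (CV_disk_inside (fun n => Cmod (g n))).
    rewrite Rabs_pos_eq by lra. exact Hr.
Qed.

Lemma ex_series_binom_0 (g : fps) (j : nat) :
  ex_series (fun k => Cmod (g k) * binom_term 0 j k).
Proof.
  apply (ex_series_incr_n (V := R_NormedModule) _ (S j)).
  exists 0. apply (filterlim_ext (fun _ => 0)); [|apply filterlim_const].
  intros n. rewrite (sum_n_ext _ (fun _ => zero)).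
  - unfold sum_n; rewrite sum_n_m_const_zero; reflexivity.
  - intros i. unfold binom_term. rewrite pow_i by lia. rewrite !Rmult_0_r; reflexivity.
Qed.

Lemma ex_series_binom_sum (g : fps) (rho : R) (n : nat) :
  (forall j, ex_series (fun k => Cmod (g k) * binom_term rho j k)) ->
  ex_series (fun k => Cmod (g k) * binom_sum rho n k).
Proof.
  intros H; induction n as [|n IH].
  - refine (ex_series_ext _ _ _ (H 0%nat)).
    intros k; rewrite binom_sum_0; reflexivity.
  - refine (ex_series_ext _ _ _ (ex_series_plus _ _ IH (H (S n)))).
    intros k; rewrite binom_sum_next. symmetry; apply Rmult_plus_distr_l.
Qed.

(** * Dominated convergence of series *)

(** Tannery's theorem along an arbitrary filter: a finite part of the series
    tends to [0] termwise, and the rest is below the tail of the majorant. *)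
Lemma Series_dominated_0 {T : Type} (F : (T -> Prop) -> Prop) {FF : Filter F}
    (x : T -> nat -> R) (M : nat -> R) :
  ex_series M ->
  F (fun t => forall k, 0 <= x t k <= M k) ->
  (forall k, filterlim (fun t => x t k) F (locally 0)) ->
  filterlim (fun t => Series (x t)) F (locally 0).
Proof.
  intros [L HL] Hdom Hlim.
  apply filterlim_locally; intros eps.
  destruct (proj1 (filterlim_locally _ _) HL (pos_div_2 eps)) as [N HN].
  specialize (HN N (le_n _)). change (Rabs (sum_n M N - L) < eps / 2) in HN.
  assert (Hsum : filterlim (fun t => sum_n (x t) N) F (locally 0)).
  { clear HN. induction N as [|N IH].
    - apply (filterlim_ext (fun t => x t 0%nat)); [intros; rewrite sum_O; reflexivity|apply Hlim].
    - apply (filterlim_ext (fun t => plus (sum_n (x t) N) (x t (S N)))).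
      + intros t; rewrite sum_Sn; reflexivity.
      + replace 0 with (plus 0 0) by apply Rplus_0_l.
        apply (filterlim_comp_2 (H := locally 0) (G := locally 0) _ _ _ IH (Hlim (S N))).
        apply (filterlim_plus (V := R_NormedModule)). }
  pose proof (proj1 (filterlim_locally _ _) Hsum (pos_div_2 eps)) as Hs.
  refine (filter_imp _ _ _ (filter_and _ _ Hdom Hs)).
  intros t [Hd Ht]. change (Rabs (sum_n (x t) N - 0) < eps / 2) in Ht.
  change (Rabs (Series (x t) - 0) < eps).
  rewrite Rminus_0_r in *.
  assert (HexM : ex_series M) by (exists L; exact HL).
  assert (Hex : ex_series (x t)).
  { apply (ex_series_le (V := R_CompleteNormedModule) _ M); [|exact HexM].
    intros k. change norm with Rabs. rewrite Rabs_pos_eq; apply Hd. }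
  pose proof (Series_incr_n _ (S N) (Nat.lt_0_succ _) Hex) as E.
  pose proof (Series_incr_n _ (S N) (Nat.lt_0_succ _) HexM) as EM.
  rewrite <- sum_n_Reals in E, EM. simpl pred in E, EM.
  rewrite (is_series_unique M L HL) in EM.
  assert (Htail : 0 <= Series (fun k => x t (S N + k)%nat)
                  <= Series (fun k => M (S N + k)%nat)).
  { split.
    - apply Rle_trans with (Series (fun _ => 0 * 0)).
      + rewrite Series_scal_l; lra.
      + apply Series_le; [intros k; specialize (Hd (S N + k)%nat); lra|].
        apply (ex_series_incr_n (V := R_NormedModule) (x t)), Hex.
    - apply Series_le; [intros k; apply Hd|].
      apply (ex_series_incr_n (V := R_NormedModule) M), HexM. }
  rewrite E.
  apply Rabs_def2 in HN. apply Rabs_def2 in Ht. apply Rabs_def1; lra.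
Qed.

Lemma Cmod_series_le (u : nat -> C) (l : C) (x : nat -> R) :
  @is_series C_AbsRing C_NormedModule u l ->
  (forall k, Cmod (u k) <= x k) -> ex_series x -> Cmod l <= Series x.
Proof.
  intros Hu Hx Hex.
  assert (H1 : is_lim_seq (fun n => Cmod (sum_n u n)) (Cmod l)).
  { apply (filterlim_comp _ _ _ (sum_n u) Cmod eventually (locally (l : C_NormedModule)));
      [exact Hu|apply (@filterlim_norm C_AbsRing C_NormedModule)]. }
  apply (is_lim_seq_le _ (sum_n x) (Cmod l) (Series x)) in H1; [exact H1| |].
  - intros n; apply Cmod_sum_n_le; intros; apply Hx.
  - apply Series_correct, Hex.
Qed.

(** * Coefficientwise convergence *)

(** The trace on [D] of the neighbourhoods of [f]; as a filter it gives access
    to the limit theorems for products and sums. *)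
Definition near_within (D : fps -> Prop) (f : fps) (P : fps -> Prop) : Prop :=
  exists d, 0 < d /\ forall h, D h -> fps_dist h f < d -> P h.

Global Instance near_within_filter (D : fps -> Prop) (f : fps) : Filter (near_within D f).
Proof.
  constructor.
  - exists 1; split; [lra|auto].
  - intros P Q [d [Hd HP]] [e [He HQ]]. exists (Rmin d e); split; [apply Rmin_pos; assumption|].
    intros h Dh Hh. pose proof (Rmin_l d e). pose proof (Rmin_r d e).
    split; [apply HP|apply HQ]; auto; lra.
  - intros P Q HPQ [d [Hd HP]]. exists d; split; auto.
Qed.

Lemma near_within_self (D : fps -> Prop) (f : fps) (P : fps -> Prop) :
  D f -> near_within D f P -> P f.
Proof.
  intros Df [d [Hd HP]]. apply HP; [exact Df|].
  rewrite (proj2 (fps_dist_refl f f) eq_refl). exact Hd.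
Qed.

Lemma near_within_dom (D : fps -> Prop) (f : fps) : near_within D f D.
Proof. exists 1; split; [lra|auto]. Qed.

(** Limits are taken in the uniform structure that [C] has as a ring with
    absolute value, whose balls are discs for [Cmod]; products and sums are
    then both continuous for the same structure. *)
Notation Clim F u l := (filterlim u F (@locally (AbsRing_UniformSpace C_AbsRing) l)).

Lemma Clim_Cmod {T : Type} (F : (T -> Prop) -> Prop) {FF : Filter F} (u : T -> C) (l : C) :
  Clim F u l <-> forall eps : posreal, F (fun t => Cmod (Cminus (u t) l) < eps).
Proof. exact (@filterlim_locally T (AbsRing_UniformSpace C_AbsRing) F FF u l). Qed.

Lemma Clim_const {T : Type} (F : (T -> Prop) -> Prop) {FF : Filter F} (l : C) :
  Clim F (fun _ => l) l.
Proof. exact (@filterlim_const T (AbsRing_UniformSpace C_AbsRing) F FF l). Qed.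

Lemma Clim_coef (D : fps -> Prop) (f : fps) (n : nat) :
  Clim (near_within D f) (fun h => h n) (f n).
Proof.
  apply (proj2 (Clim_Cmod _ _ _)); intros [e He]; simpl.
  assert (Hp : 0 < / 2 ^ n) by (apply Rinv_0_lt_compat, pow_lt; lra).
  exists (/ 2 ^ n * (e / (e + 1))); split.
  - apply Rmult_lt_0_compat; [exact Hp|]. apply Rdiv_lt_0_compat; lra.
  - intros h _ Hd. pose proof (fps_dist_term_le h f n) as Ht.
    unfold fps_dist_term in Ht.
    pose proof (Cmod_ge_0 (Cminus (h n) (f n))) as H0.
    set (t := Cmod (Cminus (h n) (f n))) in *.
    apply Rnot_le_lt; intros Hle.
    assert (E : forall x, 0 <= x -> x / (x + 1) = 1 - / (x + 1)) by (intros; field; lra).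
    assert (e / (e + 1) <= t / (t + 1)).
    { rewrite !E by lra. assert (/ (t + 1) <= / (e + 1)) by (apply Rinv_le_contravar; lra). lra. }
    assert (/ 2 ^ n * (e / (e + 1)) <= / 2 ^ n * (t / (t + 1)))
      by (apply Rmult_le_compat_l; lra).
    lra.
Qed.

Lemma Clim_mult {T : Type} (F : (T -> Prop) -> Prop) {FF : Filter F}
    (u v : T -> C) (l m : C) :
  Clim F u l -> Clim F v m -> Clim F (fun t => Cmult (u t) (v t)) (Cmult l m).
Proof.
  intros Hu Hv.
  apply (filterlim_comp_2 u v Cmult Hu Hv). apply (@filterlim_mult C_AbsRing).
Qed.

Lemma Clim_sum {T : Type} (F : (T -> Prop) -> Prop) {FF : Filter F}
    (u : T -> nat -> C) (l : nat -> C) (n : nat) :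
  (forall i, Clim F (fun t => u t i) (l i)) -> Clim F (fun t => sum_n (u t) n) (sum_n l n).
Proof.
  intros H; induction n as [|n IH].
  - rewrite sum_O. apply (filterlim_ext (fun t => u t 0%nat)); [|apply H].
    intros; rewrite sum_O; reflexivity.
  - rewrite sum_Sn.
    apply (filterlim_ext (fun t => Cplus (sum_n (u t) n) (u t (S n)))).
    + intros; rewrite sum_Sn; reflexivity.
    + apply (filterlim_comp_2 _ _ Cplus IH (H (S n))).
      apply (@filterlim_plus C_AbsRing (AbsRing_NormedModule C_AbsRing)).
Qed.

Lemma Clim_pow_coef (D : fps -> Prop) (f : fps) (k n : nat) :
  Clim (near_within D f) (fun h => fps_pow h k n) (fps_pow f k n).
Proof.
  revert n; induction k as [|k IH]; intros n.
  - simpl. apply Clim_const, near_within_filter.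
  - simpl; unfold fps_mul. apply (Clim_sum _ (fun h i => Cmult (h i) (fps_pow h k (n - i)%nat))).
    intros i. apply Clim_mult; [apply near_within_filter|apply Clim_coef|apply IH].
Qed.

Lemma near_within_coef_bounded (D : fps -> Prop) (f : fps) (N : nat) :
  exists A, 0 <= A /\ near_within D f (fun h => forall i, (i <= N)%nat -> Cmod (h i) <= A).
Proof.
  assert (Hone : forall n, near_within D f (fun h => Cmod (h n) <= Cmod (f n) + 1)).
  { intros n.
    refine (filter_imp _ _ _ (proj1 (Clim_Cmod _ _ _) (Clim_coef D f n) (mkposreal 1 Rlt_0_1))).
    intros h Hh; simpl in Hh.
    replace (h n) with (Cplus (f n) (Cminus (h n) (f n))) by ring.
    eapply Rle_trans; [apply Cmod_triangle|]. lra. }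
  induction N as [|N [A [HA HN]]].
  - exists (Cmod (f 0%nat) + 1); split; [pose proof (Cmod_ge_0 (f 0%nat)); lra|].
    refine (filter_imp _ _ _ (Hone 0%nat)). intros h Hh i Hi.
    replace i with 0%nat by lia; exact Hh.
  - exists (A + (Cmod (f (S N)) + 1)). pose proof (Cmod_ge_0 (f (S N))).
    split; [lra|].
    refine (filter_imp _ _ _ (filter_and _ _ HN (Hone (S N)))).
    intros h [H1 H2] i Hi.
    destruct (Nat.eq_dec i (S N)) as [->|Hne]; [lra|].
    specialize (H1 i ltac:(lia)). lra.
Qed.

(** Dominated convergence with majorant [2^(-n)], which bounds the terms of the
    metric whatever the two series are. *)
Lemma filterlim_fps_dist {T : Type} (F : (T -> Prop) -> Prop) {FF : Filter F}
    (u : T -> fps) (l : fps) :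
  (forall n, Clim F (fun t => u t n) (l n)) ->
  filterlim (fun t => fps_dist (u t) l) F (locally 0).
Proof.
  intros H. unfold fps_dist.
  apply (Series_dominated_0 F _ (fun n => (/ 2) ^ n)).
  - apply ex_series_geom. rewrite Rabs_pos_eq; lra.
  - apply filter_forall. intros t k; apply fps_dist_term_bounds.
  - intros n. apply filterlim_locally; intros eps.
    refine (filter_imp _ _ _ (proj1 (Clim_Cmod F _ _) (H n) eps)).
    intros t Ht. change (Rabs (fps_dist_term (u t) l n - 0) < eps).
    rewrite Rminus_0_r, Rabs_pos_eq by apply fps_dist_term_bounds.
    eapply Rle_lt_trans; [|exact Ht]. unfold fps_dist_term.
    pose proof (Cmod_ge_0 (Cminus (u t n) (l n))) as H0.
    set (x := Cmod (Cminus (u t n) (l n))) in *.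
    assert (Hx : 0 <= x / (x + 1) <= x).
    { assert (Hi : 0 < / (x + 1) <= / 1)
        by (split; [apply Rinv_0_lt_compat|apply Rinv_le_contravar]; lra).
      rewrite Rinv_1 in Hi. unfold Rdiv. split; nra. }
    assert (Hp : 0 < / 2 ^ n <= / 1).
    { split; [apply Rinv_0_lt_compat, pow_lt; lra|].
      apply Rinv_le_contravar; [lra|apply pow_R1_Rle; lra]. }
    rewrite Rinv_1 in Hp. nra.
Qed.

(** * Continuity of composition *)

(** The difference of the [n]-th coefficients of [g o h] and [g o f] is a series
    of differences; each tends to [0] as [h] tends to [f], and all are below
    twice a summable majorant independent of [h]. *)
Lemma fps_comp_continuous_of_majorant (g f : fps) (rho : R) :
  0 <= rho ->
  (forall j, ex_series (fun k => Cmod (g k) * binom_term rho j k)) ->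
  fps_comp_dom g f ->
  near_within (fps_comp_dom g) f (fun h => Cmod (h 0%nat) <= rho) ->
  fps_continuous_at_on (fps_comp_dom g) (fps_comp g) f.
Proof.
  intros Hrho Hser Df Hnear.
  set (D := fps_comp_dom g) in *. set (F := near_within D f) in *.
  assert (Hcoef : forall n, Clim F (fun h => fps_comp g h n) (fps_comp g f n)).
  { intros n. apply (proj2 (Clim_Cmod _ _ _)).
    destruct (near_within_coef_bounded D f n) as [A [HA Hbd]].
    (* [M] also dominates at [f] itself, since [f] lies in the domain. *)
    set (M := fun k => (1 + A) ^ n * (Cmod (g k) * binom_sum rho n k)).
    assert (HM : ex_series M).
    { apply (ex_series_scal_l (V := R_NormedModule) ((1 + A) ^ n)).
      apply ex_series_binom_sum, Hser. }
    assert (Hdom : F (fun h => forall k, Cmod (fps_comp_term g h n k) <= M k)).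
    { refine (filter_imp _ _ _ (filter_and _ _ Hnear Hbd)). intros h [H1 H2] k.
      unfold fps_comp_term, M. rewrite Cmod_mult.
      replace ((1 + A) ^ n * (Cmod (g k) * binom_sum rho n k))
        with (Cmod (g k) * ((1 + A) ^ n * binom_sum rho n k)) by ring.
      apply Rmult_le_compat_l; [apply Cmod_ge_0|].
      apply (fps_pow_coef_bound h rho A n); auto. }
    pose proof (near_within_self D f _ Df Hdom) as Hdomf.
    set (x := fun h k => Cmod (Cminus (fps_comp_term g h n k) (fps_comp_term g f n k))).
    assert (Hx : F (fun h => forall k, 0 <= x h k <= 2 * M k)).
    { refine (filter_imp _ _ _ Hdom). intros h Hh k. split; [apply Cmod_ge_0|].
      unfold x, Cminus. eapply Rle_trans; [apply Cmod_triangle|].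
      rewrite Cmod_opp. specialize (Hh k). specialize (Hdomf k). lra. }
    assert (H2M : ex_series (fun k => 2 * M k))
      by apply (ex_series_scal_l (V := R_NormedModule) 2 M HM).
    assert (HS : filterlim (fun h => Series (x h)) F (locally 0)).
    { apply (Series_dominated_0 F x _ H2M Hx). intros k.
      assert (Ht : Clim F (fun h => fps_comp_term g h n k) (fps_comp_term g f n k)).
      { apply Clim_mult; [apply near_within_filter|apply Clim_const, near_within_filter|apply Clim_pow_coef]. }
      apply filterlim_locally; intros eps.
      refine (filter_imp _ _ _ (proj1 (Clim_Cmod F _ _) Ht eps)).
      intros h Hh. change (Rabs (x h k - 0) < eps).
      rewrite Rminus_0_r, Rabs_pos_eq by apply Cmod_ge_0. exact Hh. }
    intros eps. pose proof (proj1 (filterlim_locally _ _) HS eps) as Hsmall.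
    refine (filter_imp _ _ _ (filter_and _ _ (filter_and _ _ Hx Hsmall) (near_within_dom D f))).
    intros h [[Hb Hs] Dh]. change (Rabs (Series (x h) - 0) < eps) in Hs.
    rewrite Rminus_0_r in Hs.
    eapply Rle_lt_trans; [|exact (Rle_lt_trans _ _ _ (Rle_abs _) Hs)].
    apply (Cmod_series_le (fun k => Cminus (fps_comp_term g h n k) (fps_comp_term g f n k))).
    - exact (is_series_minus _ _ _ _ (fps_comp_correct g h n Dh) (fps_comp_correct g f n Df)).
    - intros k; apply Rle_refl.
    - apply (ex_series_le (V := R_CompleteNormedModule) _ (fun k => 2 * M k)); [|exact H2M].
      intros k. change norm with Rabs. rewrite Rabs_pos_eq; apply Hb. }
  intros eps Heps.
  destruct (proj1 (filterlim_locally _ _) (filterlim_fps_dist F _ _ Hcoef) (mkposreal eps Heps))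
    as [d [Hd H]].
  exists d; split; [exact Hd|]. intros h [Dh Hh].
  specialize (H h Dh Hh). change (Rabs (fps_dist (fps_comp g h) (fps_comp g f) - 0) < eps) in H.
  rewrite Rminus_0_r in H. exact (Rle_lt_trans _ _ _ (Rle_abs _) H).
Qed.

(** Approximating [f] inside the domain never leaves the closed disc of
    convergence, so the circle itself causes no trouble. *)
Lemma near_within_comp_dom_radius (g f : fps) (r : R) :
  fps_radius g = Finite r ->
  near_within (fps_comp_dom g) f (fun h => Cmod (h 0%nat) <= r).
Proof.
  intros E. refine (filter_imp _ _ _ (near_within_dom _ f)). intros h Dh.
  pose proof (fps_comp_dom_radius g h Dh) as H. rewrite E in H. exact H.
Qed.

Lemma Rbar_between (x : R) (l : Rbar) : Rbar_lt x l -> exists y, x < y /\ Rbar_lt y l.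
Proof.
  destruct l as [l| |]; simpl; intros H.
  - exists ((x + l) / 2); lra.
  - exists (x + 1); split; [lra|exact I].
  - contradiction.
Qed.

Theorem theorem3p1 (g : fps) :
  (fps_radius g = Finite 0 -> fps_continuous_on (fps_comp_dom g) (fps_comp g))
  /\
  (Rbar_lt (Finite 0) (fps_radius g) ->
   forall f : fps, fps_comp_dom g f ->
     (Rbar_lt (Finite (Cmod (f 0%nat))) (fps_radius g)
      \/
      (Rbar_lt (fps_radius g) p_infty
       /\ Finite (Cmod (f 0%nat)) = fps_radius g
       /\ Rbar_lt (Finite 0) (fps_deg f))) ->
     fps_continuous_at_on (fps_comp_dom g) (fps_comp g) f).
Proof.
  split.
  - intros E f Df. apply (fps_comp_continuous_of_majorant g f 0); auto.
    + lra.
    + apply ex_series_binom_0.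
    + apply near_within_comp_dom_radius, E.
  - intros _ f Df [Hin|[_ [E Hdeg]]].
    + destruct (Rbar_between _ _ Hin) as [rho' [H1 H2]].
      set (rho := (Cmod (f 0%nat) + rho') / 2).
      pose proof (Cmod_ge_0 (f 0%nat)) as H0.
      assert (Hrho : Cmod (f 0%nat) < rho < rho') by (unfold rho; lra).
      apply (fps_comp_continuous_of_majorant g f rho); auto.
      * lra.
      * intros j. apply (ex_series_binom_inside g rho rho' j); [lra|exact H2].
      * assert (He : 0 < rho - Cmod (f 0%nat)) by lra.
        refine (filter_imp _ _ _ (proj1 (Clim_Cmod _ _ _) (Clim_coef _ f 0) (mkposreal _ He))).
        intros h Hh; simpl in Hh.
        replace (h 0%nat) with (Cplus (f 0%nat) (Cminus (h 0%nat) (f 0%nat))) by ring.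
        eapply Rle_trans; [apply Cmod_triangle|]. lra.
    + apply (fps_comp_continuous_of_majorant g f (Cmod (f 0%nat))); auto.
      * apply Cmod_ge_0.
      * intros j. apply ex_series_binom_boundary; assumption.
      * apply near_within_comp_dom_radius. symmetry; exact E.
Qed.
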